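(* Every nilpotent complex Leibniz algebra of dimension $3$ is isomorphic to one of the following Leibniz algebras on $\mathbb{C}^3$ with basis $\{e_1,e_2,e_3\}$ (all products of basis vectors not written are zero): $\mu_1$: $\mu_1(e_1,e_1)=e_2$, $\mu_1(e_2,e_1)=e_3$; $\mu_{2,b}$ for some $b\in\mathbb{C}$: $\mu_{2,b}(e_1,e_1)=e_2$, $\mu_{2,b}(e_3,e_3)=b\,e_2$, $\mu_{2,b}(e_1,e_3)=e_2$; $\mu_3$: $\mu_3(e_1,e_1)=e_2$, $\mu_3(e_3,e_3)=e_2$; $\mu_4$: $\mu_4(e_1,e_1)=e_2$; $\mu_5$: $\mu_5(e_1,e_2)=-e_3$, $\mu_5(e_2,e_1)=e_3$; $\mu_6=0$ (the abelian algebra).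
   Context: A Leibniz algebra law on $\mathbb{C}^n$ is a bilinear map $\mu:\mathbb{C}^n\times\mathbb{C}^n\to\mathbb{C}^n$ satisfying $\mu(x,\mu(y,z))=\mu(\mu(x,y),z)-\mu(\mu(x,z),y)$ for all $x,y,z$; the pair $\mathfrak{l}=(\mathbb{C}^n,\mu)$ is called a Leibniz algebra of dimension $n$ and is identified with its law. Put $\mathcal{C}^1(\mathfrak{l})=\mathfrak{l}$ and $\mathcal{C}^{k+1}(\mathfrak{l})=\mu(\mathcal{C}^k(\mathfrak{l}),\mathfrak{l})$ (the span of the products). $\mathfrak{l}$ is nilpotent if $\mathcal{C}^k(\mathfrak{l})=\{0\}$ for some $k\in\mathbb{N}$. Two laws $\mu,\mu'$ on $\mathbb{C}^n$ are isomorphic if there is $f\in GL(n,\mathbb{C})$ with $\mu'(x,y)=f^{-1}(\mu(f(x),f(y)))$ for all $x,y$. *)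

(* Defs.v *)
(* MathComp, with the complex numbers taken as R[i] for R : realType *)
From HB Require Import structures.
From mathcomp Require Import all_boot all_order all_algebra.
From mathcomp Require Import sesquilinear.
From mathcomp Require Import ring.
From mathcomp Require Import reals complex.
Set Implicit Arguments.
Unset Strict Implicit.
Unset Printing Implicit Defensive.
Import GRing.Theory.
Local Open Scope ring_scope.

Section LeibnizLaws.
Variables (F : fieldType) (n : nat).
Implicit Types (mu : {bilinear 'cV[F]_n -> 'cV[F]_n -> 'cV[F]_n}).
Implicit Types (U V W : {vspace 'cV[F]_n}).

Definition leibniz_identity mu : Prop :=
  forall x y z, mu x (mu y z) = mu (mu x y) z - mu (mu x z) y.

Record leibniz_law := LeibnizLaw {
  law :> {bilinear 'cV[F]_n -> 'cV[F]_n -> 'cV[F]_n};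
  lawP : leibniz_identity law
}.

(* The products of basis vectors span the same subspace as all the products;
   see mem_span_products and span_products_min. *)
Definition span_products mu U V : {vspace 'cV[F]_n} :=
  <<[seq mu u v | u <- vbasis U, v <- vbasis V]>>%VS.

Lemma mem_span_products mu U V x y :
  x \in U -> y \in V -> mu x y \in span_products mu U V.
Proof.
move=> xU yV; rewrite (coord_vbasis xU) linear_sumlz; apply: memv_suml => i _.
rewrite linearZl_LR /= memvZ // (coord_vbasis yV) linear_sumr.
apply: memv_suml => j _; rewrite linearZr_LR /= memvZ //; apply: memv_span.
by apply/allpairsP; exists ((vbasis U)`_i, (vbasis V)`_j) => /=;
  split; rewrite // mem_nth // size_tuple.
Qed.

Lemma span_products_min mu U V W :
  (forall x y, x \in U -> y \in V -> mu x y \in W) ->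
  (span_products mu U V <= W)%VS.
Proof.
move=> h; apply/span_subvP => _ /allpairsP[[x y] /= [xU yV ->]].
by apply: h; apply: vbasis_mem.
Qed.

(* Indexed from 1: lower_central mu 1 is the whole space; the value at 0,
   also the whole space, is junk. *)
Definition lower_central mu (k : nat) : {vspace 'cV[F]_n} :=
  iter k.-1 (fun U => span_products mu U fullv) fullv.

Definition nilpotent_law mu : Prop := exists k : nat, lower_central mu k = 0%VS.

Definition isomorphic_laws mu mu' : Prop :=
  exists2 f : 'M[F]_n, f \in unitmx &
    forall x y, mu' x y = invmx f *m mu (f *m x) (f *m y).

End LeibnizLaws.

Section TableLaws.
Variables (F : fieldType) (n : nat).

(* t i j is the product of the i-th and j-th basis vectors, counted from 1 *)
Definition table_law (t : nat -> nat -> 'cV[F]_n) (x y : 'cV[F]_n) : 'cV[F]_n :=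
  \sum_(i < n) \sum_(j < n) (x i 0 * y j 0) *: t i.+1 j.+1.

Lemma table_law_bilinear t : bilinear_for *:%R *:%R (table_law t).
Proof.
split=> [u' a x y|u a x y] /=; rewrite /table_law scaler_sumr -big_split /=;
  apply: eq_bigr => i _; rewrite scaler_sumr -big_split /=;
  apply: eq_bigr => j _; rewrite !mxE scalerA -scalerDl; congr (_ *: _); ring.
Qed.

Lemma table_law_delta t i j :
  table_law t (delta_mx i 0) (delta_mx j 0) = t i.+1 j.+1.
Proof.
rewrite /table_law (bigD1 i) //= (bigD1 j) //= !mxE !eqxx mulr1 scale1r.
rewrite !big1 ?addr0 // => [k /negPf ki|k /negPf kj]; last first.
  by rewrite !mxE kj mulr0 scale0r.
by apply: big1 => l _; rewrite !mxE ki mul0r scale0r.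
Qed.

HB.instance Definition _ t :=
  bilinear_isBilinear.Build F 'cV[F]_n 'cV[F]_n 'cV[F]_n *:%R *:%R
    (table_law t) (table_law_bilinear t).

End TableLaws.

Section Models.
Variable F : fieldType.

(* The standard basis vector e_k of F^3, for k = 1, 2, 3 *)
Definition ev (k : nat) : 'cV[F]_3 := \col_i (i.+1 == k)%:R.

Definition table1 (i j : nat) : 'cV[F]_3 :=
  match i, j with
  | 1%N, 1%N => ev 2
  | 2%N, 1%N => ev 3
  | _, _ => 0
  end.

Definition table2 (b : F) (i j : nat) : 'cV[F]_3 :=
  match i, j with
  | 1%N, 1%N => ev 2
  | 3%N, 3%N => b *: ev 2
  | 1%N, 3%N => ev 2
  | _, _ => 0
  end.

Definition table3 (i j : nat) : 'cV[F]_3 :=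
  match i, j with
  | 1%N, 1%N => ev 2
  | 3%N, 3%N => ev 2
  | _, _ => 0
  end.

Definition table4 (i j : nat) : 'cV[F]_3 :=
  match i, j with
  | 1%N, 1%N => ev 2
  | _, _ => 0
  end.

Definition table5 (i j : nat) : 'cV[F]_3 :=
  match i, j with
  | 1%N, 2%N => - ev 3
  | 2%N, 1%N => ev 3
  | _, _ => 0
  end.

Definition table6 (i j : nat) : 'cV[F]_3 := 0.

Local Notation i1 := (ord0 : 'I_3).
Local Notation i2 := (lift ord0 ord0 : 'I_3).
Local Notation i3 := (lift ord0 (lift ord0 ord0) : 'I_3).

Local Ltac expand_table :=
  rewrite /table_law !big_ord_recl !big_ord0 /= !scaler0 !(addr0, add0r).
Local Ltac check_leibniz lawE := move=> x y z;
  rewrite /= !lawE; apply/colP => k; rewrite !mxE /=; ring.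

Lemma table1_lawE x y : table_law table1 x y =
  (x i1 0 * y i1 0) *: ev 2 + (x i2 0 * y i1 0) *: ev 3.
Proof. by expand_table. Qed.

Lemma table1_leibniz : leibniz_identity (table_law table1).
Proof. check_leibniz table1_lawE. Qed.

Lemma table2_lawE b x y : table_law (table2 b) x y =
  (x i1 0 * y i1 0) *: ev 2 + (x i1 0 * y i3 0) *: ev 2
  + (x i3 0 * y i3 0) *: (b *: ev 2).
Proof. by expand_table. Qed.

Lemma table2_leibniz b : leibniz_identity (table_law (table2 b)).
Proof. check_leibniz table2_lawE. Qed.

Lemma table3_lawE x y : table_law table3 x y =
  (x i1 0 * y i1 0) *: ev 2 + (x i3 0 * y i3 0) *: ev 2.
Proof. by expand_table. Qed.

Lemma table3_leibniz : leibniz_identity (table_law table3).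
Proof. check_leibniz table3_lawE. Qed.

Lemma table4_lawE x y : table_law table4 x y =
  (x i1 0 * y i1 0) *: ev 2.
Proof. by expand_table. Qed.

Lemma table4_leibniz : leibniz_identity (table_law table4).
Proof. check_leibniz table4_lawE. Qed.

Lemma table5_lawE x y : table_law table5 x y =
  (x i1 0 * y i2 0) *: - ev 3 + (x i2 0 * y i1 0) *: ev 3.
Proof. by expand_table. Qed.

Lemma table5_leibniz : leibniz_identity (table_law table5).
Proof. check_leibniz table5_lawE. Qed.

Lemma table6_lawE x y : table_law table6 x y =
  0.
Proof. by expand_table. Qed.

Lemma table6_leibniz : leibniz_identity (table_law table6).
Proof. check_leibniz table6_lawE. Qed.

Definition mu1 : leibniz_law F 3 := LeibnizLaw table1_leibniz.
Definition mu2 (b : F) : leibniz_law F 3 := LeibnizLaw (table2_leibniz b).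
Definition mu3 : leibniz_law F 3 := LeibnizLaw table3_leibniz.
Definition mu4 : leibniz_law F 3 := LeibnizLaw table4_leibniz.
Definition mu5 : leibniz_law F 3 := LeibnizLaw table5_leibniz.
Definition mu6 : leibniz_law F 3 := LeibnizLaw table6_leibniz.

End Models.

(* Main.v *)
Require Import Defs.
From mathcomp Require Import all_boot all_order all_algebra.
From mathcomp Require Import sesquilinear.
From mathcomp Require Import reals complex.
From mathcomp Require Import boolp.
Set Implicit Arguments.
Unset Strict Implicit.
Unset Printing Implicit Defensive.
Import GRing.Theory Num.Theory.
Local Open Scope ring_scope.

(** Write [C k] for the lower central series of a nilpotent law [mu] on a space
    of dimension 3.  As long as it is nonzero it decreases strictly
    ([dim_lower_central_lt]), so [C 2] has dimension at most 2, and the proof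
    splits on that dimension.

    Dimension 0: all products vanish, which is the abelian law.

    Dimension 2: some [x] spans the space modulo [C 2].  Such an [x] generates
    the algebra: each [C k.+1] is spanned modulo [C k.+2] by the iterated right
    product of [x] with itself ([lower_central_generated]).  If [(xx)x] were 0
    then [C 3] would be equal to [C 4], hence 0, and [C 2] would be the line of
    [xx].  So [(xx)x != 0], and [x, xx, (xx)x] is a basis in which the law is
    [mu1] ([isomorphic_mu1]).

    Dimension 1: [C 3 = 0], so the line [C 2] is central and the law amounts to
    a nonzero bilinear form with values in this line.
    If the form is alternating and [xy != 0], the basis [x, y, yx] gives [mu5]
    ([isomorphic_mu5]).  Otherwise there is [x] with [xx != 0], and a [y]
    outside the span of [x] and [xx] with [yx = 0]
    ([exists_left_orthogonal]).  In the basis [x, xx, y] only two structure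
    constants are left: [xy = c xx] and [yy = d xx].  Rescaling [y] by [s]
    turns them into [s c] and [s ^ 2 d]: if [c != 0] one makes [c = 1] and gets
    [mu2]; if [c = 0] one gets [mu4] when [d = 0], and [mu3] otherwise, with
    the help of a square root of [d] ([isomorphic_mu2_mu3_mu4]). *)

(** * The lower central series of a Leibniz algebra *)

Section LowerCentralSeries.
Variables (F : fieldType) (n : nat) (mu : leibniz_law F n).
Local Notation C := (lower_central mu).

Lemma mul_square x y : mu y (mu x x) = 0.
Proof. by rewrite lawP subrr. Qed.

Lemma mem_lower_central_succ k x y : x \in C k.+1 -> mu x y \in C k.+2.
Proof. by move=> xC; apply: mem_span_products xC (memvf y). Qed.

Lemma mem_lower_central2 x y : mu x y \in C 2.
Proof. exact/mem_lower_central_succ/memvf. Qed.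

Lemma lower_central_succ_sub k : (C k.+2 <= C k.+1)%VS.
Proof.
elim: k => [|k IHk]; first exact: subvf.
apply: span_products_min => x y /(subvP IHk) xC _.
exact: mem_lower_central_succ.
Qed.

(** The series is defined by products on the right, but the Leibniz identity
    rewrites [x (u v)] as [(x u) v - (x v) u], so that induction on [j] makes it
    a filtration for products of elements of any two degrees. *)
Lemma lower_central_mul i j x y :
  x \in C i.+1 -> y \in C j.+1 -> mu x y \in C (i + j).+2.
Proof.
elim: j i x y => [|j IHj] i x y xC.
  by rewrite addn0 => _; exact: mem_lower_central_succ.
(* The good y form a subspace, so only products u v have to be considered. *)
pose f := linfun (mu x).
suff sub : (C j.+2 <= f @^-1: C (i + j.+1).+2)%VS.
  by move/(subvP sub); rewrite -memv_preim lfunE.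
apply: span_products_min => u v uC _; rewrite -memv_preim lfunE /= lawP addnS.
apply: memvB; first by apply: mem_lower_central_succ; apply: IHj.
by rewrite -addSn; apply: IHj => //; apply: mem_lower_central_succ.
Qed.

Lemma lower_central2_central u y :
  C 3 = 0%VS -> u \in C 2 -> mu u y = 0 /\ mu y u = 0.
Proof.
move=> C30 uC; split; apply/eqP; rewrite -memv0 -C30.
  exact: mem_lower_central_succ.
by apply: (@lower_central_mul 0) => //; exact: memvf.
Qed.

Lemma lower_central_stable k m : C k.+2 = C k.+1 -> C (k + m).+1 = C k.+1.
Proof.
move=> stab; elim: m => [|m IHm]; first by rewrite addn0.
by rewrite addnS -stab /lower_central /= -!/(lower_central _ _.+1) IHm.
Qed.

(** If one step were not strict, the series would be constant from there on,
    and nilpotency would make it 0 at that step. *)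
Lemma dim_lower_central_lt k :
  nilpotent_law mu -> C k.+1 != 0%VS -> (\dim (C k.+2) < \dim (C k.+1))%N.
Proof.
move=> [m Cm0]; apply: contraNltn => le_dim.
have stab : C k.+2 = C k.+1.
  by apply/eqP; rewrite eqEdim lower_central_succ_sub.
have Ck m' : C m'.+1 = 0%VS -> C k.+1 = 0%VS.
  move=> C0; rewrite -(lower_central_stable m' stab).
  elim: (k) => [//|k' IH]; rewrite addSn; apply/eqP; rewrite -subv0 -IH.
  exact: lower_central_succ_sub.
(* The value of the series at the junk index 0 is its value at 1. *)
by apply/eqP; case: m Cm0 => [|m]; [exact: (Ck 0%N)|exact: Ck].
Qed.

Lemma dim_lower_central_le_pred k :
  nilpotent_law mu -> (\dim (C k.+2) <= (\dim (C k.+1)).-1)%N.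
Proof.
move=> nil; have [C0|Cn0] := eqVneq (C k.+1) 0%VS.
  by rewrite (leq_trans (dimvS (lower_central_succ_sub _))) // C0 dimv0.
by have := dim_lower_central_lt nil Cn0; case: (\dim (C k.+1)).
Qed.

(** An element of [C k.+1] is [a p + w] with [w] in [C k.+2], and any element
    is [b x + w'] with [w'] in [C 2].  In their product only [a b (p x)]
    escapes [C k.+3]; the term [p w'] does not, by [lower_central_mul]. *)
Lemma lower_central_generated x k :
  (fullv <= <[x]> + C 2)%VS ->
  (C k.+1 <= <[iter k (mu^~ x) x]> + C k.+2)%VS.
Proof.
move=> genx; elim: k => [//|k IHk]; set p := iter k _ x in IHk.
have pC : p \in C k.+1.
  rewrite /p; elim: (k) => [|m IHm]; first exact: memvf.
  exact: mem_lower_central_succ.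
apply: span_products_min => u v.
move=> /(subvP IHk)/memv_addP[_ /vlineP[a ->] [w wC ->]].
move=> /(subvP genx)/memv_addP[_ /vlineP[b ->] [w' w'C ->]].
rewrite linearDl linearDr linearZl_LR linearZr_LR /= scalerA -addrA.
apply: memv_add; first by rewrite memvZ ?memv_line.
apply: memvD; last exact: mem_lower_central_succ.
by rewrite linearZl_LR memvZ //= -(addn1 k); apply: lower_central_mul.
Qed.

End LowerCentralSeries.

(** * Recognizing a law from its table in some basis *)

Section AdaptedBasis.
Variables (F : fieldType) (n : nat).
Implicit Types e : n.-tuple 'cV[F]_n.

Definition frame e : 'M[F]_n := \matrix_(i, j) e`_j i 0.

Lemma frame_delta e j : frame e *m delta_mx j 0 = e`_j.
Proof. by apply/colP => i; rewrite -colE !mxE. Qed.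

Lemma frame_mul e (x : 'cV_n) : frame e *m x = \sum_j x j 0 *: e`_j.
Proof.
apply/colP => i; rewrite !mxE summxE.
by apply: eq_bigr => j _; rewrite !mxE mulrC.
Qed.

Lemma frame_unit e : free e -> frame e \in unitmx.
Proof.
move/freeP => fe; rewrite -unitmx_tr -row_free_unit -kermx_eq0.
apply/rowV0P => u /sub_kermxP/(congr1 trmx); rewrite trmx_mul trmxK trmx0.
rewrite frame_mul => /fe u0; apply/rowP => j.
by have := u0 j; rewrite !mxE.
Qed.

Lemma isomorphic_table (mu : {bilinear 'cV[F]_n -> 'cV[F]_n -> 'cV[F]_n}) t e :
  free e -> (forall i j : 'I_n, mu e`_i e`_j = frame e *m t i.+1 j.+1) ->
  isomorphic_laws mu (table_law t).
Proof.
move=> /frame_unit fU mut; exists (frame e) => // x y.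
suff -> : mu (frame e *m x) (frame e *m y) = frame e *m table_law t x y.
  by rewrite mulKmx.
rewrite 2!frame_mul linear_sumlz /table_law mulmx_sumr; apply: eq_bigr => i _.
rewrite linearZl_LR linear_sumr /= scaler_sumr mulmx_sumr.
by apply: eq_bigr => j _; rewrite linearZr_LR /= scalerA mut -scalemxAr.
Qed.

End AdaptedBasis.

Section ThreeVectors.
Variables (F : fieldType).
Implicit Types x y z : 'cV[F]_3.

Lemma frame_ev (e : 3.-tuple 'cV[F]_3) (j : 'I_3) :
  frame e *m ev F j.+1 = e`_j.
Proof.
rewrite -frame_delta; congr (_ *m _); apply/colP => i.
by rewrite !mxE andbT.
Qed.

Lemma free_triple x y z :
  (forall a b c, a *: x + b *: y + c *: z = 0 -> [/\ a = 0, b = 0 & c = 0]) ->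
  free [tuple x; y; z].
Proof.
move=> xyz0; apply/freeP => k; rewrite !big_ord_recl big_ord0 addr0 addrA.
move=> /xyz0[k0 k1 k2] i.
by case: i => [[|[|[|//]]] ?];
  [rewrite -[RHS]k0|rewrite -[RHS]k1|rewrite -[RHS]k2];
  congr k; apply: val_inj.
Qed.

(** The matrix [f] maps the standard basis to [x, y, z].  The three equations
    saying so are offered as premises of the nine products because the tables
    are written in terms of the vectors [ev F k]. *)
Lemma isomorphic_table3 (mu : {bilinear 'cV[F]_3 -> 'cV[F]_3 -> 'cV[F]_3}) t
    x y z (f := frame [tuple x; y; z]) :
  free [tuple x; y; z] ->
  (f *m ev F 1 = x -> f *m ev F 2 = y -> f *m ev F 3 = z ->
   [/\ [/\ mu x x = f *m t 1 1, mu x y = f *m t 1 2 & mu x z = f *m t 1 3],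
       [/\ mu y x = f *m t 2 1, mu y y = f *m t 2 2 & mu y z = f *m t 2 3] &
       [/\ mu z x = f *m t 3 1, mu z y = f *m t 3 2 & mu z z = f *m t 3 3]])%N ->
  isomorphic_laws mu (table_law t).
Proof.
move=> fr h.
have [] := h (frame_ev _ ord0) (frame_ev _ (lift ord0 ord0))
             (frame_ev _ ord_max).
move=> [h11 h12 h13] [h21 h22 h23] [h31 h32 h33].
apply: isomorphic_table fr _.
by do 2![case=> [[|[|[|//]]] ?] /=].
Qed.

Lemma dim_cV3 : \dim {:'cV[F]_3} = 3%N.
Proof. by rewrite dimvf dim_matrix. Qed.

End ThreeVectors.

Lemma exists_complement_line (F : fieldType) (V : vectType F) (U : {vspace V}) :
  (\dim U).+1 = \dim {:V} -> exists x, (fullv <= <[x]> + U)%VS.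
Proof.
move=> dimU; have /subvPn[x _ xU] : ~~ (fullv <= U)%VS.
  by apply/negP => /dimvS; rewrite -dimU ltnn.
exists x; suff -> : (<[x]> + U)%VS = fullv by [].
apply/eqP; rewrite eqEdim subvf -dimU /=.
rewrite ltn_neqAle dimvS ?addvSr // andbT.
apply: contraNneq xU => dimE; have /eqP-> : U == (<[x]> + U)%VS.
  by rewrite eqEdim addvSr -dimE /=.
by apply: (subvP (addvSl _ _)); exact: memv_line.
Qed.

(** * Dimension 3 with a derived algebra of dimension 2 *)

Section DerivedPlane.
Variables (F : fieldType) (mu : leibniz_law F 3).
Local Notation C := (lower_central mu).

(** Multiplying a linear relation between [x, xx, (xx)x] by [x] on the right
    shifts it, so its coefficients vanish one after the other.  Products by
    [xx] or [(xx)x] on the right vanish by the Leibniz identity alone. *)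
Lemma isomorphic_mu1 x : C 4 = 0%VS -> mu (mu x x) x != 0 ->
  isomorphic_laws mu (mu1 F).
Proof.
move=> C40 xxx0.
have xxxx0 y : mu (mu (mu x x) x) y = 0.
  apply/eqP; rewrite -memv0 -C40.
  by do 3!apply: mem_lower_central_succ; exact: memvf.
have yxxx0 y : mu y (mu (mu x x) x) = 0.
  by rewrite lawP !mul_square linear0l subrr.
apply: (@isomorphic_table3 _ _ _ x (mu x x) (mu (mu x x) x)).
  apply: free_triple => a b c abc.
  have a0 : a = 0.
    have := congr1 (fun u => mu (mu u x) x) abc.
    rewrite /= !(linearDl, linearZl_LR, linear0l) /= !xxxx0 !linear0l.
    rewrite !scaler0 !addr0 => /eqP.
    by rewrite scaler_eq0 (negPf xxx0) orbF => /eqP.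
  rewrite a0 scale0r add0r in abc.
  have b0 : b = 0.
    have := congr1 (mu^~ x) abc.
    rewrite /= !(linearDl, linearZl_LR, linear0l) /= !xxxx0.
    rewrite !scaler0 !addr0 => /eqP.
    by rewrite scaler_eq0 (negPf xxx0) orbF => /eqP.
  move/eqP: abc; rewrite b0 scale0r add0r scaler_eq0 (negPf xxx0) orbF.
  by move/eqP.
by move=> _ fy fz; rewrite /= !mulmx0 fy fz !mul_square !yxxx0 !xxxx0.
Qed.

Lemma exists_nonzero_cube : nilpotent_law mu -> \dim (C 2) = 2%N ->
  exists x, mu (mu x x) x != 0.
Proof.
move=> nil dim2.
have [|x genx] := @exists_complement_line _ _ (C 2).
  by rewrite dim2 dim_cV3.
exists x; apply: contra_eq_neq dim2 => xxx0.
have C30 : C 3 = 0%VS.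
  apply/eqP; apply: contraTT (lower_central_generated 2 genx) => C3n0.
  rewrite /= xxx0 (_ : <[0]>%VS = 0%VS) ?add0v; last first.
    by apply/eqP; rewrite -subv0 -memvE mem0v.
  apply: contraTN (dim_lower_central_lt nil C3n0).
  by move=> /dimvS; rewrite -leqNgt.
rewrite neq_ltn; apply/orP; left; rewrite ltnS.
have := lower_central_generated 1 genx; rewrite C30 addv0 => /dimvS /leq_trans.
by apply; rewrite dim_vline leq_b1.
Qed.

End DerivedPlane.

(** * Dimension 3 with a derived algebra of dimension 1 *)

Section DerivedLine.
Variables (F : fieldType) (mu : leibniz_law F 3).
Local Notation C := (lower_central mu).
Hypothesis C30 : C 3 = 0%VS.

Let product_central u v : (forall w, mu (mu u v) w = 0) /\
                          (forall w, mu w (mu u v) = 0).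
Proof.
by split=> w; have [] := lower_central2_central w C30 (mem_lower_central2 mu u v).
Qed.

Lemma isomorphic_mu5 x y :
  (forall z, mu z z = 0) -> mu x y != 0 -> isomorphic_laws mu (mu5 F).
Proof.
move=> alt xy0.
have anti u v : mu u v = - mu v u.
  have := alt (u + v); rewrite linearDl !linearDr /= !alt addr0 add0r.
  by move/eqP; rewrite addr_eq0 => /eqP.
have [cl cr] := product_central y x.
apply: (@isomorphic_table3 _ _ _ x y (mu y x)).
  apply: free_triple => a b c abc.
  have b0 : b = 0.
    have := congr1 (mu^~ x) abc; rewrite /= !linearDl !linearZl_LR linear0l /=.
    rewrite alt cl !scaler0 add0r addr0 => /eqP.
    by rewrite scaler_eq0 anti oppr_eq0 (negPf xy0) orbF => /eqP.
  have a0 : a = 0.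
    have := congr1 (mu^~ y) abc; rewrite /= !linearDl !linearZl_LR linear0l /=.
    rewrite alt cl !scaler0 !addr0 => /eqP.
    by rewrite scaler_eq0 (negPf xy0) orbF => /eqP.
  move/eqP: abc; rewrite a0 b0 !scale0r !add0r scaler_eq0 anti oppr_eq0.
  by rewrite (negPf xy0) orbF => /eqP.
by move=> _ _ fz; rewrite /= !mulmx0 mulmxN fz !alt !cl !cr -anti.
Qed.

(** The common shape of the tables of [mu2], [mu3] and [mu4]. *)
Definition form_table (c d : F) (i j : nat) : 'cV[F]_3 :=
  match i, j with
  | 1%N, 1%N => ev F 2
  | 1%N, 3%N => c *: ev F 2
  | 3%N, 3%N => d *: ev F 2
  | _, _ => 0
  end.

Section NonAlternating.
Variable x : 'cV[F]_3.
Hypothesis xx0 : mu x x != 0.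
Local Notation xx := (mu x x).

Lemma product_in_line u v : \dim (C 2) = 1%N -> exists a, mu u v = a *: xx.
Proof.
move=> dim1; apply/vlineP.
have /eqP-> : <[xx]>%VS == C 2; last exact: mem_lower_central2.
by rewrite eqEdim dim1 dim_vline xx0 -memvE mem_lower_central2.
Qed.

(** Any [y] outside the span can be corrected by a multiple of [x], because
    [xx] spans all products. *)
Lemma exists_left_orthogonal :
  \dim (C 2) = 1%N -> exists2 y, y \notin <<[:: x; xx]>>%VS & mu y x = 0.
Proof.
move=> dim1; have /subvPn[y _ yS] : ~~ (fullv <= <<[:: x; xx]>>)%VS.
  by apply/negP => /dimvS; rewrite dim_cV3 => /leq_trans/(_ (dim_span _)).
have [a yx] := product_in_line y x dim1.
exists (y - a *: x); last by rewrite linearBl linearZl_LR /= yx subrr.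
apply: contra yS => yS; rewrite -(subrK (a *: x) y) memvD //.
by rewrite memvZ // memv_span // mem_head.
Qed.

Lemma free_square y :
  y \notin <<[:: x; xx]>>%VS -> free [tuple x; xx; y].
Proof.
move=> yS; apply: free_triple => a b c abc.
have xS : x \in <<[:: x; xx]>>%VS by rewrite memv_span ?mem_head.
have xxS : xx \in <<[:: x; xx]>>%VS by rewrite memv_span ?inE ?eqxx ?orbT.
have c0 : c = 0.
  apply: contraNeq yS => c0; rewrite -[y](scalerK c0) memvZ //.
  move/eqP: abc; rewrite addrC addr_eq0 => /eqP->.
  by rewrite memvN memvD // memvZ.
rewrite c0 scale0r addr0 in abc.
have a0 : a = 0.
  have := congr1 (mu^~ x) abc; rewrite /= linearDl !linearZl_LR linear0l /=.
  rewrite (product_central x x).1 scaler0 addr0 => /eqP.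
  by rewrite scaler_eq0 (negPf xx0) orbF => /eqP.
move/eqP: abc; rewrite a0 scale0r add0r scaler_eq0 (negPf xx0) orbF.
by move=> /eqP.
Qed.

Lemma isomorphic_form_table t y c d :
  y \notin <<[:: x; xx]>>%VS ->
  mu y x = 0 -> mu x y = c *: xx -> mu y y = d *: xx ->
  t =2 form_table c d -> isomorphic_laws mu (table_law t).
Proof.
move=> yS yx xy yy tE; have [cl cr] := product_central x x.
apply: isomorphic_table3 (free_square yS) _ => _ fxx _.
by rewrite !tE !mulmx0 -!scalemxAr fxx !cl !cr yx xy yy.
Qed.

End NonAlternating.
End DerivedLine.

Lemma isomorphic_mu2_mu3_mu4 (F : numClosedFieldType) (mu : leibniz_law F 3) x :
  lower_central mu 3 = 0%VS -> \dim (lower_central mu 2) = 1%N ->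
  mu x x != 0 ->
  [\/ exists b, isomorphic_laws mu (mu2 b), isomorphic_laws mu (mu3 F) |
     isomorphic_laws mu (mu4 F)].
Proof.
move=> C30 dim1 xx0.
have [y yS yx] := exists_left_orthogonal xx0 dim1.
have [c xy] := product_in_line xx0 x y dim1.
have [d yy] := product_in_line xx0 y y dim1.
have scaleS s : s != 0 -> s *: y \notin <<[:: x; mu x x]>>%VS.
  by move=> s0; apply: contra yS => ?; rewrite -[y](scalerK s0) memvZ.
have formE s t : s != 0 -> t =2 form_table (s * c) (s ^+ 2 * d) ->
    isomorphic_laws mu (table_law t).
  move=> s0; apply: (isomorphic_form_table C30 xx0 (scaleS s s0)).
  - by rewrite linearZl_LR /= yx scaler0.
  - by rewrite linearZr_LR /= xy scalerA.
  - by rewrite linearZl_LR linearZr_LR /= yy !scalerA expr2.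
have [c0|c0] := eqVneq c 0; last first.
  apply: Or31; exists (c^-1 ^+ 2 * d).
  apply: (@formE c^-1); rewrite ?invr_eq0 // mulVf //.
  by case=> [|[|[|[|i]]]] [|[|[|[|j]]]] //=; rewrite ?scale1r.
have [d0|d0] := eqVneq d 0.
  apply: Or33; apply: (@formE 1); rewrite ?oner_eq0 // c0 d0 !mulr0.
  by case=> [|[|[|[|i]]]] [|[|[|[|j]]]] //=; rewrite ?scale0r.
apply: Or32; apply: (@formE (sqrtC d)^-1).
  by rewrite invr_eq0 sqrtC_eq0.
rewrite c0 mulr0 exprVn sqrtCK mulVf //.
by case=> [|[|[|[|i]]]] [|[|[|[|j]]]] //=; rewrite ?scale1r ?scale0r.
Qed.

(** * The classification *)

Lemma nilpotent_leibniz3_classification (F : numClosedFieldType)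
    (mu : leibniz_law F 3) : nilpotent_law mu ->
  isomorphic_laws mu (mu1 F) \/
  (exists b : F, isomorphic_laws mu (mu2 b)) \/
  isomorphic_laws mu (mu3 F) \/
  isomorphic_laws mu (mu4 F) \/
  isomorphic_laws mu (mu5 F) \/
  isomorphic_laws mu (mu6 F).
Proof.
move=> nil; pose C := lower_central mu.
have C_eq0 k : (\dim (C k) <= 0)%N -> C k = 0%VS.
  by rewrite leqn0 dimv_eq0 => /eqP.
have dim2le : (\dim (C 2) <= 2)%N.
  by have := dim_lower_central_le_pred 0 nil; rewrite dim_cV3.
have dim3 := dim_lower_central_le_pred 1 nil.
have dim4 := dim_lower_central_le_pred 2 nil.
case dim2: (\dim (C 2)) dim2le => [|[|[|//]]] _; rewrite dim2 in dim3.
- do 5!right; exists 1%:M; first exact: unitmx1.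
  move=> x y; rewrite !mul1mx; have := mem_lower_central2 mu x y.
  rewrite -/C C_eq0 ?dim2 // memv0 => /eqP->.
  by rewrite mulmx0 [LHS]table6_lawE.
- have C30 := C_eq0 _ dim3.
  have [[x xx0]|no_square] := EM (exists x, mu x x != 0).
    have [i2|i3|i4] := isomorphic_mu2_mu3_mu4 C30 dim2 xx0.
    + by right; left.
    + by do 2!right; left.
    + by do 3!right; left.
  have alt z : mu z z = 0.
    by apply: contrapT => zz; apply: no_square; exists z; apply/eqP.
  have [[x [y xy0]]|no_product] := EM (exists x y, mu x y != 0).
    by do 4!right; left; exact: isomorphic_mu5 xy0.
  suff /dimvS : (C 2 <= 0)%VS by rewrite dim2 dimv0.
  apply: span_products_min => x y _ _; rewrite memv0.
  by apply: contrapT => /negP xy0; apply: no_product; exists x, y.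
- left; have [x xxx0] := exists_nonzero_cube nil dim2.
  apply: isomorphic_mu1 xxx0; apply: (C_eq0 4%N).
  by rewrite (leq_trans dim4) // -subn1 leq_subLR.
Qed.

Theorem theorem1 (R : realType) (L : leibniz_law R[i] 3)
    (hL : nilpotent_law L) :
  isomorphic_laws L (mu1 R[i]) \/
  (exists b : R[i], isomorphic_laws L (mu2 b)) \/
  isomorphic_laws L (mu3 R[i]) \/
  isomorphic_laws L (mu4 R[i]) \/
  isomorphic_laws L (mu5 R[i]) \/
  isomorphic_laws L (mu6 R[i]).
Proof. exact: nilpotent_leibniz3_classification. Qed.
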